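(* For all integers $k,\ell\ge 3$: 1. $\gamma_{gr}^{t}(P_k\,\square\,P_\ell)\ge k\ell-\min\{k,\ell\}$; 2. $\gamma_{gr}^{t}(P_k\,\square\,C_\ell)\ge k\ell-\min\{2k,\ell\}$; 3. $\gamma_{gr}^{t}(C_k\,\square\,C_\ell)\ge k\ell-\min\{2k,2\ell\}$.
   Context: $P_n$ and $C_n$ denote the path and the cycle on $n$ vertices. $N(v)$ denotes the open neighborhood of $v$. A sequence $(v_1,\ldots,v_m)$ of distinct vertices of a graph $G$ is a (legal) open neighborhood sequence if $N(v_i)\setminus\bigcup_{j=1}^{i-1}N(v_j)\neq\emptyset$ for each $i$. The Grundy total domination number $\gamma_{gr}^{t}(G)$ is the maximum length of a legal open neighborhood sequence of $G$. The Cartesian product $G\,\square\,H$ has vertex set $V(G)\times V(H)$, and $(g_1,h_1)$, $(g_2,h_2)$ are adjacent iff $g_1g_2\in E(G)$ and $h_1=h_2$, or $g_1=g_2$ and $h_1h_2\in E(H)$. *)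

(* Defs.v *)
From mathcomp Require Import all_boot.

Set Implicit Arguments.
Unset Strict Implicit.
Unset Printing Implicit Defensive.

(* A finite simple graph is a symmetric irreflexive adjacency relation [e] on
   a finType; the lemmas below check both properties for the graphs used. *)

Definition open_nbhd (T : finType) (e : rel T) (v : T) : {set T} :=
  [set w | e v w].

Definition legal_open_nbhd_seq (T : finType) (e : rel T) (m : nat)
    (s : m.-tuple T) : bool :=
  uniq s &&
  [forall i : 'I_m,
     open_nbhd e (tnth s i)
       :\: \bigcup_(j < m | j < i) open_nbhd e (tnth s j) != set0].

(* Lengths are bounded by #|T| since the entries of a sequence are distinct;
   the empty sequence is legal, so the maximum is never over an empty range. *)
Definition grundy_total_domination (T : finType) (e : rel T) : nat :=
  \max_(m < #|T|.+1 | [exists s : m.-tuple T, legal_open_nbhd_seq e s]) m.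

Definition path_graph (n : nat) : rel 'I_n :=
  [rel i j : 'I_n | (i.+1 == j :> nat) || (j.+1 == i :> nat)].

(* [ordS i] is i + 1 modulo n. This is the cycle C_n only for 3 <= n. *)
Definition cycle_graph (n : nat) : rel 'I_n :=
  [rel i j : 'I_n | (ordS i == j) || (ordS j == i)].

Definition cartesian_product (T U : finType) (e : rel T) (f : rel U) :
    rel (T * U) :=
  [rel x y | e x.1 y.1 && (x.2 == y.2) || (x.1 == y.1) && f x.2 y.2].

Lemma path_graph_sym n : symmetric (@path_graph n).
Proof. by move=> i j; exact: orbC. Qed.

Lemma path_graph_irr n : irreflexive (@path_graph n).
Proof. by move=> i; rewrite /path_graph /= orbb gtn_eqF. Qed.

Lemma cycle_graph_sym n : symmetric (@cycle_graph n).
Proof. by move=> i j; exact: orbC. Qed.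

Lemma cycle_graph_irr n : 1 < n -> irreflexive (@cycle_graph n).
Proof.
move=> n_gt1 i; rewrite /cycle_graph /= orbb -val_eqE /=; apply/eqP.
have := ltn_ord i; rewrite leq_eqVlt => /orP[/eqP iE|lt_i].
  by rewrite iE modnn => i0; move: n_gt1; rewrite -iE -i0.
by rewrite modn_small // => /esym/n_Sn.
Qed.

Lemma cartesian_product_sym (T U : finType) (e : rel T) (f : rel U) :
  symmetric e -> symmetric f -> symmetric (cartesian_product e f).
Proof.
by move=> eC fC x y; rewrite /cartesian_product /= eC fC (eq_sym x.1) (eq_sym x.2).
Qed.

Lemma cartesian_product_irr (T U : finType) (e : rel T) (f : rel U) :
  irreflexive e -> irreflexive f -> irreflexive (cartesian_product e f).
Proof. by move=> eI fI x; rewrite /cartesian_product /= eI fI !eqxx. Qed.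

Lemma legal_leq_grundy (T : finType) (e : rel T) (m : nat) (s : m.-tuple T) :
  legal_open_nbhd_seq e s -> m <= grundy_total_domination e.
Proof.
move=> legal_s; have /andP[uniq_s _] := legal_s.
have m_lt : m < #|T|.+1.
  by rewrite ltnS -[X in X <= _](size_tuple s) -(card_uniqP uniq_s) max_card.
rewrite /grundy_total_domination; apply: (bigmax_sup (Ordinal m_lt)) => //=.
by apply/existsP; exists s.
Qed.

Lemma grundy_attained (T : finType) (e : rel T) :
  exists s : (grundy_total_domination e).-tuple T, legal_open_nbhd_seq e s.
Proof.
rewrite /grundy_total_domination.
have ex0 : [exists s : (@ord0 #|T|).-tuple T, legal_open_nbhd_seq e s].
  by apply/existsP; exists [tuple]; apply/andP; split=> //; apply/forallP=> -[].
rewrite (@bigmax_eq_arg _ ord0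
  (fun m : 'I_#|T|.+1 => [exists s : m.-tuple T, legal_open_nbhd_seq e s])) //.
by case: arg_maxnP => //= m /existsP[s legal_s] _; exists s.
Qed.

(* Main.v *)
Require Import Defs.
From mathcomp Require Import all_boot zify.

(** In [P_(m+1) □ H] list the vertices of the first [m] layers, layer by layer:
    [(i, x)] is the first vertex of the list adjacent to [(i+1, x)], so the list
    is legal and has length [m |H|].  The Grundy total domination number is
    monotone under induced subgraphs and [C_(m+2)] contains an induced
    [P_(m+1)], which gives the bound [m |H|] for [C_(m+2) □ H] as well. *)

Set Implicit Arguments.
Unset Strict Implicit.
Unset Printing Implicit Defensive.

(** List the [v x] by increasing rank [r x]: any other listed vertex adjacent to [w x] has larger
    rank, hence comes later, so [w x] is new when [v x] is reached. Ties in rank may be broken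
    arbitrarily. *)
Lemma card_leq_grundy (S T : finType) (e : rel T) (v w : S -> T) (r : S -> nat) :
    (forall x, e (v x) (w x)) ->
    (forall x y, e (v y) (w x) -> y != x -> r x < r y) ->
  #|S| <= grundy_total_domination e.
Proof.
move=> e_vw r_lt.
(* If [v x = v y] with [x != y], each of [w x], [w y] is adjacent to both, so each rank would be
   strictly below the other. *)
have v_inj : injective v.
  move=> x y vxy; apply/eqP/contraT => neq_xy.
  have lt_xy : r x < r y by apply: r_lt; rewrite 1?eq_sym // -vxy.
  have lt_yx : r y < r x by apply: r_lt; rewrite // vxy.
  by rewrite ltnNge ltnW in lt_xy.
pose le_r := relpre r leq; pose t := sort le_r (enum S).
have le_r_tr : transitive le_r by move=> x y z; exact: leq_trans.
have t_sorted : sorted le_r t by apply: sort_sorted => x y; exact: leq_total.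
have t_uniq : uniq t by rewrite sort_uniq enum_uniq.
have size_t : size t == #|S| by rewrite size_sort -cardE.
apply: (@legal_leq_grundy _ _ _ (map_tuple v (Tuple size_t))).
apply/andP; split; first by rewrite /= map_inj_uniq.
apply/forallP => i; have x0 : S := tnth (Tuple size_t) i.
apply/set0Pn; exists (w (tnth (Tuple size_t) i)).
rewrite !inE tnth_map e_vw andbT; apply/bigcupP => -[j lt_ji].
rewrite inE tnth_map => /r_lt; rewrite !(tnth_nth x0) /=.
have [i_t j_t] : i < size t /\ j < size t by rewrite (eqP size_t) !ltn_ord.
rewrite nth_uniq // => /(_ (negbT (ltn_eqF lt_ji))).
have le_ji : r (nth x0 t j) <= r (nth x0 t i).
  exact: (sorted_ltn_nth le_r_tr x0 t_sorted).
by rewrite ltnNge le_ji.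
Qed.

(** The image under [h] of a legal sequence is legal: [h] preserves adjacency, so [h x] is still
    dominated at step [i], and reflects it, so [h x] was not dominated before. *)
Lemma grundy_induced (T U : finType) (e : rel T) (f : rel U) (h : T -> U) :
    injective h -> {mono h : x y / e x y >-> f x y} ->
  grundy_total_domination e <= grundy_total_domination f.
Proof.
move=> h_inj h_mono; have [s /andP[s_uniq /forallP s_legal]] := grundy_attained e.
apply: (@legal_leq_grundy _ _ _ (map_tuple h s)).
apply/andP; split; first by rewrite /= map_inj_uniq.
apply/forallP => i; have /set0Pn[x] := s_legal i.
rewrite !inE => /andP[x_new x_i]; apply/set0Pn; exists (h x).
rewrite !inE tnth_map h_mono x_i andbT; apply: contra x_new.
case/bigcupP => j lt_ji; rewrite inE tnth_map h_mono => x_j.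
by apply/bigcupP; exists j; rewrite ?inE.
Qed.

Lemma grundy_cartesianC (T U : finType) (e : rel T) (f : rel U) :
  grundy_total_domination (cartesian_product e f)
    <= grundy_total_domination (cartesian_product f e).
Proof.
apply: (@grundy_induced _ _ _ _ (fun x => (x.2, x.1))).
  by move=> [a b] [c d] [-> ->].
by move=> x y; rewrite /cartesian_product /= orbC andbC [in X in _ || X]andbC.
Qed.

Lemma grundy_cartesian_inducedl (T T' U : finType) (e : rel T) (e' : rel T')
    (f : rel U) (h : T -> T') :
    injective h -> {mono h : x y / e x y >-> e' x y} ->
  grundy_total_domination (cartesian_product e f)
    <= grundy_total_domination (cartesian_product e' f).
Proof.
move=> h_inj h_mono; apply: (@grundy_induced _ _ _ _ (fun x => (h x.1, x.2))).
  by move=> [a b] [c d] [/h_inj -> ->].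
by move=> x y; rewrite /cartesian_product /= h_mono (inj_eq h_inj).
Qed.

Lemma grundy_path_cartesian (m : nat) (U : finType) (f : rel U) :
  m * #|U| <= grundy_total_domination (cartesian_product (@path_graph m.+1) f).
Proof.
rewrite -[X in X * _]card_ord -card_prod.
(* The rank is the layer index; [lift ord0] sends layer [i] to layer [i+1]. *)
apply: (@card_leq_grundy _ _ _
  (fun x => (widen_ord (leqnSn m) x.1, x.2)) (fun x => (lift ord0 x.1, x.2))
  (fun x => x.1)).
  by case=> i x; rewrite /cartesian_product /path_graph /= /bump /= add1n !eqxx.
case=> i x [j y]; rewrite /cartesian_product /path_graph /= /bump /= add1n.
(* A neighbour of [(i+1, x)] is [(i, x)] itself, or [(i+2, x)], or lies in layer [i+1]; the last two
   have rank above [i]. *)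
case/orP=> [/andP[/orP[/eqP[ji]|/eqP<-] /eqP ->]|/andP[/eqP/(congr1 val)/= -> _]].
- by rewrite (val_inj ji : j = i) eqxx.
- by rewrite ltnW.
- by [].
Qed.

Lemma grundy_cycle_cartesian (m : nat) (U : finType) (f : rel U) :
  m * #|U| <= grundy_total_domination (cartesian_product (@cycle_graph m.+2) f).
Proof.
apply: leq_trans (grundy_path_cartesian m f) _.
apply: (@grundy_cartesian_inducedl _ _ _ _ _ _ (widen_ord (leqnSn m.+1))).
  by move=> i j /(congr1 val) /= /val_inj.
move=> i j; rewrite /path_graph /cycle_graph /= -!val_eqE /=.
(* The image omits the last vertex [m+1] of the cycle, so successors of image vertices never wrap
   around. *)
by rewrite !modn_small // ltnS.
Qed.

Theorem theorem5p2 (k l : nat) (hk : 3 <= k) (hl : 3 <= l) :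
  [/\ grundy_total_domination
        (cartesian_product (@path_graph k) (@path_graph l))
        >= k * l - minn k l,
      grundy_total_domination
        (cartesian_product (@path_graph k) (@cycle_graph l))
        >= k * l - minn (2 * k) l
    & grundy_total_domination
        (cartesian_product (@cycle_graph k) (@cycle_graph l))
        >= k * l - minn (2 * k) (2 * l)].
Proof.
case: k hk => [|[|k]] // _; case: l hl => [|[|l]] // _.
have sub_minn n a b g : n - a <= g -> n - b <= g -> n - minn a b <= g by lia.
split; apply: sub_minn.
(* Layers along a path factor lose one copy of the other factor, along a cycle factor two. Bounds
   subtracting [k] or [2 * k] layer along the second factor, hence the swap. *)
- apply: leq_trans (grundy_cartesianC _ _).
  by apply: leq_trans (grundy_path_cartesian _ _); rewrite card_ord; lia.
- by apply: leq_trans (grundy_path_cartesian _ _); rewrite card_ord; lia.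
- apply: leq_trans (grundy_cartesianC _ _).
  by apply: leq_trans (grundy_cycle_cartesian _ _); rewrite card_ord; lia.
- by apply: leq_trans (grundy_path_cartesian _ _); rewrite card_ord; lia.
- apply: leq_trans (grundy_cartesianC _ _).
  by apply: leq_trans (grundy_cycle_cartesian _ _); rewrite card_ord; lia.
- by apply: leq_trans (grundy_cycle_cartesian _ _); rewrite card_ord; lia.
Qed.
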